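(* Let $E\in\mathbb R^{k\times N}$ be a nonzero matrix, $A\in\mathbb R^{m\times N}$, $y\in\mathbb R^m$, $C\in\mathbb R^{p\times N}$, $d\in\mathbb R^p$, $\eta>0$, and let $f:\mathbb R^m\to\mathbb R$ be a $C^1$ strictly convex function. Suppose the problem $$(\mathrm{D2}):\quad\min_{x\in\mathbb R^N}f(Ax-y)\quad\text{subject to}\quad\|Ex\|_1\le\eta,\ \ Cx\ge d$$ has an optimal solution, let $x^*\in\mathbb R^N$ be a feasible point of (D2), and let $\alpha$, $\mathcal S$, $b$ be as defined in the context. C.1. Suppose $\|Ex^*\|_1<\eta$. Then $x^*$ is the unique minimizer of (D2) if and only if the matrix $\begin{bmatrix}A\\C_{\alpha\bullet}\end{bmatrix}$ has full column rank, and there exist $w\in\mathbb R^m$, $w'\in\mathbb R^{|\alpha|}_{++}$ and $u\in\mathbb R^{|\alpha|}_+$ such that $A^Tw=C_{\alpha\bullet}^Tw'$ and $A^T\nabla f(Ax^*-y)=C_{\alpha\bullet}^Tu$. C.2. Suppose $\|Ex^*\|_1=\eta$. Then $x^*$ is the unique minimizer of (D2) if and only if the following conditions hold: (a) the matrix $\begin{bmatrix}A\\ C_{\alpha\bullet}\\ E_{\mathcal S^c\bullet}\end{bmatrix}$ has full column rank; (b) there exist $u\in\mathbb R^m$, $u'\in\mathbb R^{|\alpha|}_{++}$, and $u''\in\mathbb R^{|\mathcal S^c|}$ with $\|u''\|_\infty<1$ such that $A^Tu+C_{\alpha\bullet}^Tu'-E_{\mathcal S^c\bullet}^Tu''=b$;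 (c) there exist $\widetilde u\in\mathbb R^{|\alpha|}_+$, $\mu\in\mathbb R_+$, and $\widetilde u'\in\mathbb R^{|\mathcal S^c|}$ with $\|\widetilde u'\|_\infty\le1$ such that $A^T\nabla f(Ax^*-y)-C_{\alpha\bullet}^T\widetilde u+\mu\cdot\big(b+E_{\mathcal S^c\bullet}^T\widetilde u'\big)=0$.
   Context: Vector inequalities are componentwise; $\mathbb R^n_+$ and $\mathbb R^n_{++}$ are the nonnegative and (strictly) positive orthants. For a matrix $M$ and row index set $\beta$, $M_{\beta\bullet}$ is the submatrix of rows indexed by $\beta$. Given $x^*$: $\alpha:=\{i\in\{1,\ldots,p\}\mid(Cx^*-d)_i=0\}$; $\mathcal S:=\{i\in\{1,\ldots,k\}\mid(Ex^* )_i\ne0\}$ with complement $\mathcal S^c$ in $\{1,\ldots,k\}$; $\widehat b:=\mathrm{sgn}((Ex^* )_{\mathcal S})\in\{\pm1\}^{|\mathcal S|}$ (componentwise sign) and $b:=E_{\mathcal S\bullet}^T\widehat b\in\mathbb R^N$ (so $b=0$ if $\mathcal S=\emptyset$). *)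

(* Defs.v *)
From HB Require Import structures.
From mathcomp Require Import all_boot all_order all_algebra.
From mathcomp Require Import all_classical all_reals all_analysis.

Set Implicit Arguments.
Unset Strict Implicit.
Unset Printing Implicit Defensive.

Import Order.TTheory GRing.Theory Num.Theory.
Import numFieldNormedType.Exports.

Local Open Scope classical_set_scope.
Local Open Scope ring_scope.

(* [rows_of B M] is the submatrix of [M] on the rows indexed by [B], in
   increasing order; applied to a column vector it restricts the vector. *)
Definition rows_of (R : Type) (n q : nat) (B : {set 'I_n}) (M : 'M[R]_(n, q)) :
    'M[R]_(#|B|, q) :=
  rowsub (@enum_val _ (mem B)) M.

Definition vle (R : realType) (n : nat) (u v : 'cV[R]_n) : Prop :=
  forall i, u i 0 <= v i 0.

Definition vlt (R : realType) (n : nat) (u v : 'cV[R]_n) : Prop :=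
  forall i, u i 0 < v i 0.

Definition norm1 (R : realType) (n : nat) (v : 'cV[R]_n) : R :=
  \sum_i `|v i 0|.

Definition full_col_rank (R : realType) (r n : nat) (M : 'M[R]_(r, n)) : Prop :=
  \rank M = n.

Definition strictly_convex (R : realType) (m : nat) (f : 'cV[R]_m -> R) : Prop :=
  forall (x y : 'cV[R]_m) (t : R), x != y -> 0 < t -> t < 1 ->
    f (t *: x + (1 - t) *: y) < t * f x + (1 - t) * f y.

Definition gradient (R : realType) (m : nat) (f : 'cV[R]_m -> R)
    (x : 'cV[R]_m) : 'cV[R]_m :=
  \col_i 'D_(delta_mx i 0) f x.

Definition C1 (R : realType) (m : nat) (f : 'cV[R]_m -> R) : Prop :=
  (forall x, differentiable f x) /\ continuous (gradient f).

Definition minimizer (R : realType) (T : Type) (F : T -> R) (D : set T) (x : T) :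
    Prop :=
  D x /\ forall z, D z -> F x <= F z.

Definition unique_minimizer (R : realType) (T : Type) (F : T -> R) (D : set T)
    (x : T) : Prop :=
  minimizer F D x /\ forall z, minimizer F D z -> z = x.

Definition D2_objective (R : realType) (m N : nat) (f : 'cV[R]_m -> R)
    (A : 'M[R]_(m, N)) (y : 'cV[R]_m) (x : 'cV[R]_N) : R :=
  f (A *m x - y).

Definition D2_feasible (R : realType) (k p N : nat) (E : 'M[R]_(k, N))
    (C : 'M[R]_(p, N)) (d : 'cV[R]_p) (eta : R) : set 'cV[R]_N :=
  [set x | norm1 (E *m x) <= eta /\ vle d (C *m x)].

Definition active_set (R : realType) (p N : nat) (C : 'M[R]_(p, N))
    (d : 'cV[R]_p) (x : 'cV[R]_N) : {set 'I_p} :=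
  [set i | (C *m x - d) i 0 == 0]%SET.

Definition supp (R : realType) (k N : nat) (E : 'M[R]_(k, N))
    (x : 'cV[R]_N) : {set 'I_k} :=
  [set i | (E *m x) i 0 != 0]%SET.

Definition bhat (R : realType) (k N : nat) (E : 'M[R]_(k, N)) (x : 'cV[R]_N) :
    'cV[R]_#|supp E x| :=
  map_mx Num.sg (rows_of (supp E x) (E *m x)).

Definition bvec (R : realType) (k N : nat) (E : 'M[R]_(k, N)) (x : 'cV[R]_N) :
    'cV[R]_N :=
  (rows_of (supp E x) E)^T *m bhat E x.

(* Main.v *)
Require Import Defs.
From HB Require Import structures.
From mathcomp Require Import all_boot all_order all_algebra.
From mathcomp Require Import all_classical all_reals all_analysis.
From mathcomp Require Import ring lra.
Import Order.TTheory GRing.Theory Num.Theory.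
Import numFieldNormedType.Exports.
Local Open Scope classical_set_scope.
Local Open Scope ring_scope.

(* Let K be the cone of feasible directions at x*. Since the objective is a
   strictly convex function of A x, the point x* is the unique minimizer iff no
   nonzero h in K satisfies A h = 0 and the derivative of the objective is
   nonnegative along K. When the norm constraint is inactive, K is
   {h | C_alpha h >= 0}; when it is active, the extra inequality
   b^T h + |E_{S^c} h|_1 <= 0 appears, and K is the projection of a polyhedral
   cone in the variables (h, t) with |E_{S^c} h| <= t. The first condition is
   then dualized by Stiemke's theorem, the second one by Farkas' lemma; the
   bounds on u'' and on the multiplier of E_{S^c} come from writing these as
   (p1 - p2) / mu where p1, p2 >= 0 and p1 + p2 = mu. *)

Set Implicit Arguments.
Unset Strict Implicit.

(** * Componentwise order and the pairing of nonnegative vectors *)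

Lemma vle0P (R : realType) (n : nat) (u : 'cV[R]_n) :
  vle 0 u <-> forall i, 0 <= u i 0.
Proof. by split=> u0 i; have := u0 i; rewrite mxE. Qed.

Lemma vlt0P (R : realType) (n : nat) (u : 'cV[R]_n) :
  vlt 0 u <-> forall i, 0 < u i 0.
Proof. by split=> u0 i; have := u0 i; rewrite mxE. Qed.

Lemma vle_col_mx (R : realType) (m n : nat) (u : 'cV[R]_m) (v : 'cV[R]_n) :
  vle 0 (col_mx u v) <-> vle 0 u /\ vle 0 v.
Proof.
split=> [uv|[u0 v0] i]; last first.
  by rewrite !mxE; case: splitP => j _; [have := u0 j | have := v0 j]; rewrite mxE.
by split=> i; [have := uv (lshift n i) | have := uv (rshift m i)];
  rewrite ?col_mxEu ?col_mxEd !mxE.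
Qed.

Lemma vlt_col_mx (R : realType) (m n : nat) (u : 'cV[R]_m) (v : 'cV[R]_n) :
  vlt 0 (col_mx u v) -> vlt 0 u /\ vlt 0 v.
Proof.
by move=> uv; split=> i; [have := uv (lshift n i) | have := uv (rshift m i)];
  rewrite ?col_mxEu ?col_mxEd !mxE.
Qed.

Lemma dot_ge0 (R : realType) (n : nat) (u v : 'cV[R]_n) :
  vle 0 u -> vle 0 v -> 0 <= (u^T *m v) 0 0.
Proof.
move=> u0 v0; rewrite mxE; apply: sumr_ge0 => i _.
by have := u0 i; have := v0 i; rewrite !mxE => ? ?; exact: mulr_ge0.
Qed.

(** Complementary slackness: a sum of nonnegative terms that is at most 0 vanishes term by term, and
    the weights [u] are positive. *)
Lemma dot_eq0 (R : realType) (n : nat) (u v : 'cV[R]_n) :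
  vlt 0 u -> vle 0 v -> (u^T *m v) 0 0 <= 0 -> v = 0.
Proof.
move=> u0 v0; rewrite mxE => le0.
have ge0 i : true -> 0 <= u^T 0 i * v i 0.
  move=> _; have := u0 i; have := v0 i; rewrite !mxE => ? ?.
  by apply: mulr_ge0 => //; exact: ltW.
have /eqP : \sum_i u^T 0 i * v i 0 = 0.
  by apply/eqP; rewrite eq_le le0 sumr_ge0.
rewrite psumr_eq0// => /allP uv0; apply/matrixP => i j; rewrite ord1 mxE.
have := uv0 i (mem_index_enum _); rewrite mulf_eq0 mxE => /orP[|/eqP//].
by have := u0 i; rewrite mxE => /lt0r_neq0/negbTE ->.
Qed.

(** * Theorems of the alternative: Farkas and Stiemke *)

(* Induction on the rows: if the first row [a] is not redundant, some [x] with
   [a x = -1] satisfies the other constraints and has [c x < 0]; projecting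
   along [x] onto the kernel of [a] eliminates that row. *)
Lemma farkas (R : realType) (n N : nat) (M : 'M[R]_(n, N)) (c : 'cV[R]_N) :
  (forall h, vle 0 (M *m h) -> 0 <= (c^T *m h) 0 0) ->
  exists2 l, vle 0 l & M^T *m l = c.
Proof.
elim: n M c => [|n IHn] M c cP.
  exists 0; first by move=> i; rewrite lexx.
  rewrite mulmx0; apply/esym/matrixP => i j; rewrite ord1 mxE.
  have /(_ _)/cP : forall h, vle 0 (M *m h) by move=> h; case.
  (* Without rows every [h] is admissible; [h = - c] bounds the sum of squares of [c] by 0. *)
  move=> /(_ (- c)); rewrite mulmxN mxE oppr_ge0 => cc.
  apply/eqP; rewrite -sqrf_eq0.
  have /allP/(_ i (mem_index_enum _)) : all (fun i => c i 0 ^+ 2 == 0) (index_enum _).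
    rewrite -(@psumr_eq0 _ _ _ xpredT) => [|k _]; last exact: sqr_ge0.
    rewrite eq_le; apply/andP; split; last by apply: sumr_ge0 => k _; exact: sqr_ge0.
    apply: le_trans cc; rewrite mxE; apply: ler_sum => k _.
    by rewrite mxE expr2.
  by [].
move: M cP; rewrite -[n.+1]/(1 + n)%N => M cP.
have [[x [x0 cx]]|no] := pselect (exists x : 'cV[R]_N,
    vle 0 (dsubmx M *m x) /\ (c^T *m x) 0 0 < 0); last first.
  have [|l l0 lc] := IHn (dsubmx M) c.
    move=> h h0; rewrite leNgt; apply/negP => hc; apply: no; by exists h.
  exists (col_mx (0 : 'cV[R]_1) l).
    by apply/vle_col_mx; split => // i; rewrite lexx.
  rewrite -[M]vsubmxK tr_col_mx mul_row_col mulmx0 add0r; exact: lc.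
set a := usubmx M in x0 *.
set M' := dsubmx M in x0 *.
have ME : M = col_mx a M' by rewrite vsubmxK.
have ax : (a *m x) 0 0 < 0.
  rewrite ltNge; apply/negP => ax; have : vle 0 (M *m x).
    by rewrite ME mul_col_mx; apply/vle_col_mx; split => //;
       apply/vle0P => i; rewrite ord1.
  by move=> /cP; rewrite leNgt cx.
wlog ax1 : x x0 cx ax / (a *m x) 0 0 = -1.
  pose r := - ((a *m x) 0 0)^-1; have r0 : 0 < r by rewrite oppr_gt0 invr_lt0.
  move=> /(_ (r *: x)); apply.
  - by apply/vle0P => i; rewrite -scalemxAr mxE mulr_ge0 ?(ltW r0)//;
       move: i; apply/vle0P.
  - by rewrite -scalemxAr mxE nmulr_llt0.
  - by rewrite -scalemxAr mxE nmulr_llt0.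
  - by rewrite -scalemxAr mxE mulNr mulVf// lt_eqF.
(* Since [a x = -1], the map [h + x (a h)] projects onto the kernel of [a]. The new matrix and the
   new vector are [M'] and [c^T] composed with this projection. *)
have [|l l0 lc] := IHn (M' + M' *m x *m a) (c + a^T *m (c^T *m x)).
  move=> h h0.
  have ha1 : (a *m (h + x *m (a *m h))) = 0.
    rewrite mulmxDr mulmxA [a *m x]mx11_scalar ax1 mul_scalar_mx scaleN1r.
    exact: subrr.
  have : vle 0 (M *m (h + x *m (a *m h))).
    rewrite ME mul_col_mx ha1; apply/vle_col_mx; split => [i|]; first by rewrite lexx.
    by move: h0; rewrite mulmxDl mulmxDr !mulmxA.
  move=> /cP; rewrite mulmxDr mulmxA linearD/= trmx_mul trmxK mulmxDl.
  rewrite (_ : (c^T *m x)^T = c^T *m x) ?mulmxA// [c^T *m x]mx11_scalar.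
  by rewrite tr_scalar_mx.
(* Expanding [lc] leaves this scalar as the coefficient of [a]. It is nonnegative because
   [M' x >= 0], [l >= 0] and [c^T x < 0]. *)
exists (col_mx ((M' *m x)^T *m l - c^T *m x) l).
  apply/vle_col_mx; split => //; apply/vle0P => i; rewrite ord1.
  rewrite mxE [X in _ + X]mxE addr_ge0//; last by rewrite oppr_ge0 ltW.
  exact: dot_ge0.
move: lc; rewrite ME tr_col_mx mul_row_col mulmxBr linearD/= trmx_mul mulmxDl.
by rewrite -mulmxA addrAC [_ + M'^T *m _]addrC => ->; rewrite addrK.
Qed.

(** Each row of [M] vanishes on the cone, so Farkas writes its negative with a multiplier
    [l i >= 0]. Then [l i] plus the i-th unit vector lies in the kernel of [M^T] and is positive at
    [i]; summing over [i] makes all entries positive. *)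
Lemma stiemke (R : realType) (n N : nat) (M : 'M[R]_(n, N)) :
  (forall h, vle 0 (M *m h) -> M *m h = 0) ->
  exists2 l, vlt 0 l & M^T *m l = 0.
Proof.
move=> MP.
have /choice[l lP] i : exists l : 'cV[R]_n, vle 0 l /\ M^T *m l = - (row i M)^T.
  have [|l l0 lE] := @farkas _ _ _ M (- (row i M)^T); last by exists l.
  move=> h /MP h0; rewrite linearN/= trmxK mulNmx -row_mul h0.
  by rewrite !mxE oppr0.
exists (\sum_i (l i + delta_mx i 0)).
  move=> i; rewrite summxE mxE (bigD1 i)//= ltr_wpDr//.
    apply: sumr_ge0 => j _; rewrite !mxE addr_ge0//.
    by have [/(_ i)] := lP j; rewrite mxE.
  rewrite !mxE !eqxx ltr_wpDl//.
  by have [/(_ i)] := lP i; rewrite mxE.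
rewrite mulmx_sumr big1// => i _; rewrite mulmxDr (proj2 (lP i)).
by rewrite -colE -tr_row addNr.
Qed.

(** * Full column rank, and duality of the sup norm and the 1-norm *)

Lemma full_col_rankP (R : realType) (r n : nat) (M : 'M[R]_(r, n)) :
  full_col_rank M <-> forall h : 'cV[R]_n, M *m h = 0 -> h = 0.
Proof.
rewrite /full_col_rank -mxrank_tr; split=> [rM h Mh|MP].
  apply/trmx_inj/eqP; rewrite trmx0 -(@mulmx_free_eq0 _ _ _ _ _ M^T).
    by rewrite -trmx_mul Mh trmx0.
  by rewrite /row_free rM.
apply/eqP; rewrite -[_ == _]/(row_free M^T) -kermx_eq0; apply/eqP/trmx_inj.
have MK : M *m (kermx M^T)^T = 0 
  by apply/trmx_inj; rewrite trmx_mul trmxK mulmx_ker trmx0.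
apply/matrixP => i j; rewrite trmx0 [RHS]mxE.
have /MP /matrixP/(_ i 0) : M *m col j (kermx M^T)^T = 0.
  by rewrite colE mulmxA MK mul0mx.
by rewrite !mxE.
Qed.

Lemma norm_cV_le (R : realType) (n : nat) (s : 'cV[R]_n) (e : R) :
  0 <= e -> `|s| <= e <-> forall i, `|s i 0| <= e.
Proof.
move=> e0; rewrite [`|s|]mx_normrE; split=> [/bigmax_leP[_ se] i|se].
  exact: (se (i, 0)).
by apply/bigmax_leP; split=> // -[i j] _; rewrite ord1; exact: se.
Qed.

Lemma norm_cV_lt (R : realType) (n : nat) (s : 'cV[R]_n) (e : R) :
  0 < e -> `|s| < e <-> forall i, `|s i 0| < e.
Proof.
move=> e0; rewrite [`|s|]mx_normrE; split=> [/bigmax_ltP[_ se] i|se].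
  exact: (se (i, 0)).
by apply/bigmax_ltP; split=> // -[i j] _; rewrite ord1; exact: se.
Qed.

Lemma norm1_ge0 (R : realType) (n : nat) (v : 'cV[R]_n) : 0 <= norm1 v.
Proof. exact: sumr_ge0. Qed.

Lemma dot_le_norm1 (R : realType) (n : nat) (s v : 'cV[R]_n) :
  `|s| <= 1 -> (s^T *m v) 0 0 <= norm1 v.
Proof.
move=> /(norm_cV_le s ler01) s1; rewrite mxE; apply: ler_sum => i _.
by rewrite mxE; apply: le_trans (ler_norm _) _; rewrite normrM ler_piMl.
Qed.

(** Equality case of Hölder: the hypothesis forces the sum of [(1 - |s_i|) |v_i|] to be at most 0,
    with positive weights. *)
Lemma dot_eq_norm1 (R : realType) (n : nat) (s v : 'cV[R]_n) :
  `|s| < 1 -> norm1 v <= (s^T *m v) 0 0 -> v = 0.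
Proof.
move=> /(norm_cV_lt s ltr01) s1 sv.
have le0 : \sum_i (1 - `|s i 0|) * `|v i 0| <= 0.
  move: sv; rewrite -subr_le0; apply: le_trans.
  rewrite mxE /norm1 -sumrB; apply: ler_sum => i _.
  rewrite mulrBl mul1r lerB// mxE.
  by apply: le_trans (ler_norm _) _; rewrite normrM.
have ge0 i : true -> 0 <= (1 - `|s i 0|) * `|v i 0|.
  by move=> _; rewrite mulr_ge0// subr_ge0 ltW.
have /eqP : \sum_i (1 - `|s i 0|) * `|v i 0| = 0.
  by apply/eqP; rewrite eq_le le0 sumr_ge0.
rewrite psumr_eq0// => /allP vi; apply/matrixP => i j; rewrite ord1 mxE.
have := vi i (mem_index_enum _); rewrite mulf_eq0 normr_eq0 => /orP[|/eqP//].
by rewrite subr_eq0 gt_eqF.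
Qed.

(** * Lifting the 1-norm inequality to a polyhedral cone *)

(* The cone [{(h, t) | 0 <= G h, |Es h| <= t, b^T h + \sum_i t_i <= 0}], whose
   projection on [h] is [{h | 0 <= G h, b^T h + norm1 (Es h) <= 0}]. *)
Definition l1_lift (R : realType) (q s N : nat) (G : 'M[R]_(q, N))
    (Es : 'M[R]_(s, N)) (b : 'cV[R]_N) :
    'M[R]_(q + ((s + s) + 1), N + s) :=
  col_mx (row_mx G 0)
    (col_mx (col_mx (row_mx (- Es) 1%:M) (row_mx Es 1%:M))
            (row_mx (- b^T) (const_mx (- 1)))).

Lemma vle_l1_lift (R : realType) (q s N : nat) (G : 'M[R]_(q, N))
    (Es : 'M[R]_(s, N)) (b h : 'cV[R]_N) (t : 'cV[R]_s) :
  vle 0 (l1_lift G Es b *m col_mx h t) <->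
  [/\ vle 0 (G *m h), forall i, `|(Es *m h) i 0| <= t i 0 &
      (b^T *m h) 0 0 + \sum_i t i 0 <= 0].
Proof.
have bE : (- b^T *m h + const_mx (- 1) *m t) 0 0 =
          - ((b^T *m h) 0 0 + \sum_i t i 0) :> R.
  rewrite mulNmx !mxE opprD; congr (_ + _); rewrite -sumrN.
  by apply: eq_bigr => i _; rewrite mxE mulN1r.
rewrite /l1_lift !mul_col_mx !mul_row_col !mul1mx mul0mx addr0 mulNmx.
have e1 i : (- (Es *m h) + t) i 0 = t i 0 - (Es *m h) i 0.
  by rewrite mxE [X in X + _]mxE addrC.
have e2 i : (Es *m h + t) i 0 = (Es *m h) i 0 + t i 0 by rewrite mxE.
split=> [/vle_col_mx[G0 /vle_col_mx[/vle_col_mx[/vle0P E1 /vle0P E2] /vle0P b0]]|].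
  split=> // [i|]; last by have := b0 0; rewrite bE oppr_ge0.
  by rewrite ler_norml; have := E1 i; have := E2 i; rewrite e1 e2; lra.
case=> G0 Et bt; apply/vle_col_mx; split=> //.
apply/vle_col_mx; split; last by apply/vle0P => i; rewrite ord1 bE oppr_ge0.
by apply/vle_col_mx; split; apply/vle0P => i; rewrite (e1, e2);
   have := Et i; rewrite ler_norml => /andP[]; lra.
Qed.

(** The columns of [h] give the equation for [c]; those of [t] give [p1 + p2 = mu]. With
    [p1, p2 >= 0] this yields [|p1 - p2| <= mu], the source of the sup norm bounds. *)
Lemma l1_lift_mul (R : realType) (q s N : nat) (G : 'M[R]_(q, N))
    (Es : 'M[R]_(s, N)) (b c : 'cV[R]_N) (v : 'cV[R]_q) (p1 p2 : 'cV[R]_s)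
    (mu : 'cV[R]_1) :
  (l1_lift G Es b)^T *m col_mx v (col_mx (col_mx p1 p2) mu) = col_mx c 0 ->
  G^T *m v + Es^T *m (p2 - p1) - mu 0 0 *: b = c /\
  forall i, p1 i 0 + p2 i 0 = mu 0 0.
Proof.
rewrite /l1_lift !tr_col_mx !tr_row_mx !mul_row_col !mul_col_mx !add_col_mx.
move=> /eq_col_mx[<- /matrixP E2]; split.
  rewrite [in RHS]linearN/= [in RHS]linearN/= trmxK !mulNmx mulmxBr.
  rewrite [in RHS](mx11_scalar mu) mul_mx_scalar -!addrA; congr (_ + _).
  exact: addrCA.
move=> i; have := E2 i 0.
rewrite trmx0 mul0mx add0r trmx1 !mul1mx !mxE big_ord1 !mxE mulN1r.
by move/eqP; rewrite subr_eq0 => /eqP.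
Qed.

(** The equation [A h = 0] is encoded as two opposite inequalities; the difference of their
    multipliers is [w], whose sign is free. *)
Lemma stiemke_eq (R : realType) (m n N : nat) (A : 'M[R]_(m, N))
    (M : 'M[R]_(n, N)) :
  (forall h, A *m h = 0 -> vle 0 (M *m h) -> M *m h = 0) ->
  exists w l, vlt 0 l /\ A^T *m w + M^T *m l = 0.
Proof.
move=> MP; have [h|l] := @stiemke _ _ _ (col_mx (col_mx A (- A)) M).
  rewrite !mul_col_mx mulNmx => /vle_col_mx[/vle_col_mx[/vle0P A1 /vle0P A2] M0].
  have A0 : A *m h = 0.
    apply/matrixP => i j; rewrite ord1 [RHS]mxE; apply/eqP.
    by rewrite eq_le A1 andbT -oppr_ge0; have := A2 i; rewrite mxE.
  by rewrite MP// A0 oppr0 !col_mx0.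
rewrite -[l]vsubmxK -[usubmx l]vsubmxK => /vlt_col_mx[_ l0].
rewrite !tr_col_mx !mul_row_col linearN/= mulNmx -mulmxBr => lE.
by exists (usubmx (usubmx l) - dsubmx (usubmx l)), (dsubmx l).
Qed.

(** * Dual descriptions of the two cone conditions *)

(** The left side says that [A] and [G] have no common kernel and that [G h >= 0] on the kernel of
    [A] forces [G h = 0]; the second half is Stiemke's condition. *)
Lemma cone_stiemke (R : realType) (m q N : nat) (A : 'M[R]_(m, N))
    (G : 'M[R]_(q, N)) :
  (forall h, vle 0 (G *m h) -> A *m h = 0 -> h = 0) <->
  full_col_rank (col_mx A G) /\
  exists w w', vlt 0 w' /\ A^T *m w = G^T *m w'.
Proof.
split=> [AG|[/full_col_rankP rk [w [w' [w'0 wE]]]] h G0 A0].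
  split.
    apply/full_col_rankP => h; rewrite mul_col_mx -[0]col_mx0 => /eq_col_mx[A0 G0].
    by apply: AG => //; rewrite G0 => i.
  have [h A0 G0|w [l [l0 lE]]] := @stiemke_eq _ _ _ _ A G.
    by rewrite (AG h)// mulmx0.
  exists (- w), l; split=> //; rewrite mulmxN; apply/esym/eqP.
  by rewrite -addr_eq0 addrC lE.
apply: rk; rewrite mul_col_mx A0 (_ : G *m h = 0) ?col_mx0//.
apply: (dot_eq0 w'0) => //.
have -> : w'^T *m (G *m h) = (G^T *m w')^T *m h.
  by rewrite trmx_mul trmxK mulmxA.
by rewrite -wE trmx_mul trmxK -mulmxA A0 mulmx0 mxE.
Qed.

Lemma cone_farkas (R : realType) (q N : nat) (G : 'M[R]_(q, N)) (c : 'cV[R]_N) :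
  (forall h, vle 0 (G *m h) -> 0 <= (c^T *m h) 0 0) <->
  exists2 u, vle 0 u & c = G^T *m u.
Proof.
split=> [/farkas[l l0 <-]|[u u0 ->] h h0]; first by exists l.
by rewrite trmx_mul trmxK -mulmxA dot_ge0.
Qed.

(** Stiemke on the lifted cone makes [p1], [p2] and [mu] all positive, which permits division by
    [mu] and makes the bound on [u''] strict. *)
Lemma l1_cone_stiemke (R : realType) (m q s N : nat) (A : 'M[R]_(m, N))
    (G : 'M[R]_(q, N)) (Es : 'M[R]_(s, N)) (b : 'cV[R]_N) :
  (forall h, vle 0 (G *m h) /\ (b^T *m h) 0 0 + norm1 (Es *m h) <= 0 ->
     A *m h = 0 -> h = 0) <->
  full_col_rank (col_mx A (col_mx G Es)) /\
  exists u u' u'', [/\ vlt 0 u', `|u''| < 1 &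
    A^T *m u + G^T *m u' - Es^T *m u'' = b].
Proof.
split=> [K0|[/full_col_rankP rk [u [u' [u'' [u'0 u''1 bE]]]]] h [G0 b0] A0].
  split.
    apply/full_col_rankP => h /eqP; rewrite !mul_col_mx !col_mx_eq0.
    case/and3P=> /eqP A0 /eqP G0 /eqP E0.
    have n0 : norm1 (0 : 'cV[R]_s) = 0.
      by apply: big1 => i _; rewrite mxE normr0.
    (* On the common kernel the norm inequality reduces to [b^T h <= 0], which holds for [h] or for
       [- h]. *)
    have [b0|/ltW b0] := lerP ((b^T *m h) 0 0) 0.
      by apply: K0 => //; rewrite G0 E0 n0 addr0; split.
    apply: oppr_inj; rewrite oppr0; apply: K0; last by rewrite mulmxN A0 oppr0.
    rewrite !mulmxN G0 E0 !oppr0 n0 addr0; split=> //.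
    by rewrite mxE oppr_le0.
  have [x A0 M0|w [l]] :=
      @stiemke_eq _ _ _ _ (row_mx A 0) (l1_lift G Es b).
    move: A0 M0; rewrite -[x]vsubmxK mul_row_col mul0mx addr0.
    set h := usubmx x; set t := dsubmx x => A0 /vle_l1_lift[G0 Et bt].
    have h0 : h = 0.
      apply: K0 => //; split=> //; apply: le_trans bt; rewrite lerD2l.
      exact: ler_sum.
    have t0 i : 0 <= t i 0 by exact: le_trans (Et i).
    suff -> : t = 0 by rewrite h0 col_mx0 mulmx0.
    apply: (@dot_eq0 _ _ (const_mx 1)) => [i||]; first by rewrite !mxE ltr01.
      exact/vle0P.
    move: bt; rewrite h0 mulmx0 mxE add0r; apply: le_trans.
    by rewrite mxE; apply: ler_sum => i _; rewrite !mxE mul1r.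
  rewrite -[l]vsubmxK -[dsubmx l]vsubmxK -[usubmx (dsubmx l)]vsubmxK.
  move: (usubmx l) (usubmx (usubmx (dsubmx l))) (dsubmx (usubmx (dsubmx l)))
    (dsubmx (dsubmx l)) => {l} v p1 p2 mu.
  case=> /vlt_col_mx[/vlt0P v0
          /vlt_col_mx[/vlt_col_mx[/vlt0P p10 /vlt0P p20] /vlt0P mu0]].
  rewrite tr_row_mx mul_col_mx trmx0 mul0mx => lE.
  have [|cE pE] := @l1_lift_mul _ _ _ _ G Es b (- (A^T *m w)) v p1 p2 mu.
    by apply/eqP; rewrite -subr_eq0 opp_col_mx opprK oppr0 addrC lE.
  have m0 := mu0 0; have mN0 := lt0r_neq0 m0.
  (* Division by [mu] normalizes the coefficient of [b] to 1. *)
  exists ((mu 0 0)^-1 *: w), ((mu 0 0)^-1 *: v), ((mu 0 0)^-1 *: (p1 - p2)).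
  split; first by apply/vlt0P => i; rewrite mxE mulr_gt0// invr_gt0.
    apply/norm_cV_lt => // i; rewrite mxE normrM gtr0_norm ?invr_gt0//.
    rewrite mulrC ltr_pdivrMr// mul1r !mxE -(pE i) ltr_norml.
    by have := p10 i; have := p20 i; lra.
  rewrite -!scalemxAr -scalerDr -scalerBr; apply: (scalerI mN0).
  rewrite scalerA divff// scale1r.
  apply/eqP; rewrite -subr_eq0 -[A^T *m w]opprK -cE !mulmxBr; apply/eqP.
  move: (G^T *m v) (Es^T *m p1) (Es^T *m p2) => X Y Z.
  by apply/matrixP => i j; rewrite !mxE; ring.
have uE : (u'^T *m (G *m h)) 0 0 =
    (u''^T *m (Es *m h)) 0 0 + (b^T *m h) 0 0.
  rewrite -bE linearB/= linearD/= mulmxBl mulmxDl !trmx_mul !trmxK -!mulmxA A0.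
  by rewrite mulmx0 add0r [X in _ + X]mxE [X in _ + (_ + X)]mxE addrC subrK.
(* By [b0] and [uE], [norm1 (Es h) <= - b^T h <= u''^T Es h], which is the equality case for a
   vector of sup norm below 1. *)
have E0 : Es *m h = 0.
  apply: (dot_eq_norm1 u''1).
  by have := dot_ge0 (fun i => ltW (u'0 i)) G0; rewrite uE; lra.
apply: rk; rewrite !mul_col_mx A0 E0 (_ : G *m h = 0) ?col_mx0//.
apply: (dot_eq0 u'0) => //; rewrite uE E0 mulmx0 mxE add0r.
by apply: le_trans b0; rewrite lerDl norm1_ge0.
Qed.

(** Farkas on the lifted cone, with [c] extended by 0 in the variables [t]; [mu] is the multiplier
    of the norm inequality. *)
Lemma l1_cone_farkas (R : realType) (q s N : nat)
    (G : 'M[R]_(q, N)) (Es : 'M[R]_(s, N)) (b c : 'cV[R]_N) :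
  (forall h, vle 0 (G *m h) /\ (b^T *m h) 0 0 + norm1 (Es *m h) <= 0 ->
     0 <= (c^T *m h) 0 0) <->
  exists v mu w, [/\ vle 0 v, 0 <= mu, `|w| <= 1 &
    c - G^T *m v + mu *: (b + Es^T *m w) = 0].
Proof.
split=> [K0|[v [mu [w [v0 mu0 w1 cE]]]] h [G0 b0]].
  have [x|l] := @farkas _ _ _ (l1_lift G Es b) (col_mx c 0).
    rewrite -[x]vsubmxK; set h := usubmx x; set t := dsubmx x => /vle_l1_lift[G0 Et bt].
    rewrite tr_col_mx mul_row_col trmx0 mul0mx addr0; apply: K0; split=> //.
    by apply: le_trans bt; rewrite lerD2l; exact: ler_sum.
  rewrite -[l]vsubmxK -[dsubmx l]vsubmxK -[usubmx (dsubmx l)]vsubmxK.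
  move: (usubmx l) (usubmx (usubmx (dsubmx l))) (dsubmx (usubmx (dsubmx l)))
    (dsubmx (dsubmx l)) => {l} v p1 p2 mu.
  case/vle_col_mx=> v0 /vle_col_mx[/vle_col_mx[/vle0P p10 /vle0P p20] /vle0P mu0].
  move=> /l1_lift_mul[<- pE].
  have m0 := mu0 0.
  (* If [mu = 0], its inverse is 0 by convention and so is the third witness; then [p1 + p2 = 0]
     with both nonnegative, so [p1 - p2] is still [mu] times that witness. *)
  exists v, (mu 0 0), ((mu 0 0)^-1 *: (p1 - p2)); split=> //.
    apply/norm_cV_le => // i; rewrite mxE normrM normfV (ger0_norm m0).
    have [->|mN0] := eqVneq (mu 0 0) 0; first by rewrite invr0 mul0r.
    rewrite mulrC ler_pdivrMr ?lt0r ?mN0// mul1r !mxE -(pE i) ler_norml.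
    by have := p10 i; have := p20 i; lra.
  have -> : mu 0 0 *: (b + Es^T *m ((mu 0 0)^-1 *: (p1 - p2))) =
      mu 0 0 *: b + Es^T *m (p1 - p2).
    rewrite scalerDr scalemxAr scalerA; congr (_ + _ *m _).
    have [mu00|mN0] := eqVneq (mu 0 0) 0; last by rewrite divff// scale1r.
    rewrite mu00 mul0r scale0r; apply/esym/matrixP => i j; rewrite ord1 !mxE.
    by have := p10 i; have := p20 i; have := pE i; lra.
  rewrite !mulmxBr; move: (G^T *m v) (Es^T *m p1) (Es^T *m p2) => X Y Z.
  by apply/matrixP => i j; rewrite !mxE; ring.
have -> : (c^T *m h) 0 0 = (v^T *m (G *m h)) 0 0
   - mu * ((b^T *m h) 0 0 + (w^T *m (Es *m h)) 0 0).
  have -> : c = G^T *m v - mu *: (b + Es^T *m w).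
    by apply/eqP; rewrite -subr_eq0 opprB addrA addrAC cE.
  rewrite linearB/= linearZ/= linearD/= mulmxBl -scalemxAl mulmxDl.
  rewrite !trmx_mul !trmxK -!mulmxA.
  by move: (v^T *m _) (b^T *m _) (w^T *m _) => X Y Z; rewrite !mxE.
rewrite subr_ge0; apply: le_trans (dot_ge0 v0 G0).
rewrite mulr_ge0_le0//; apply: le_trans b0; rewrite lerD2l.
exact: dot_le_norm1.
Qed.

(** * Directional derivatives of strictly convex functions *)

Lemma derive_gradient (R : realType) (m : nat) (f : 'cV[R]_m -> R)
    (a v : 'cV[R]_m) :
  differentiable f a -> 'D_v f a = ((gradient f a)^T *m v) 0 0.
Proof.
move=> df; rewrite deriveE// mxE [in LHS](matrix_sum_delta v) linear_sum/=.
by apply: eq_bigr => i _; rewrite big_ord1 linearZ/= !mxE deriveE// mulrC.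
Qed.

Lemma cvg_derive_right (R : realType) (m : nat) (f : 'cV[R]_m -> R)
    (a v : 'cV[R]_m) : derivable f a v ->
  t^-1 * (f (a + t *: v) - f a) @[t --> 0^'+] --> 'D_v f a.
Proof.
move=> /cvg_dnbhs_at_right; apply: cvg_trans; apply: near_eq_cvg.
by near=> t; rewrite /= [a + _]addrC.
Unshelve. all: by end_near. Qed.

Lemma derive_ge0_right (R : realType) (m : nat) (f : 'cV[R]_m -> R)
    (a v : 'cV[R]_m) : derivable f a v ->
  (\forall t \near 0^'+, f a <= f (a + t *: v)) -> 0 <= 'D_v f a.
Proof.
move=> /cvg_derive_right dv fv.
apply: (ler_cvg_to (cvg_cst 0) dv); near=> t.
have t0 : 0 < t by near: t; exact: nbhs_right_gt.
by rewrite mulr_ge0 ?invr_ge0 ?(ltW t0)// subr_ge0; near: t.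
Unshelve. all: by end_near. Qed.

Lemma derive_le_convex (R : realType) (m : nat) (f : 'cV[R]_m -> R)
    (a v : 'cV[R]_m) : derivable f a v -> strictly_convex f -> v != 0 ->
  'D_v f a <= f (a + v) - f a.
Proof.
move=> /cvg_derive_right dv fconv v0.
apply: (ler_cvg_to dv (cvg_cst (f (a + v) - f a))); near=> t.
have t0 : 0 < t by near: t; exact: nbhs_right_gt.
have t1 : t < 1 by near: t; exact: nbhs_right_lt.
have av : a + v != a by rewrite -subr_eq0 addrC addKr.
have := fconv _ _ _ av t0 t1.
rewrite (_ : t *: (a + v) + (1 - t) *: a = a + t *: v); last first.
  by apply/matrixP => i j; rewrite !mxE; ring.
by rewrite ler_pdivrMl//; lra.
Unshelve. all: by end_near. Qed.

(** Passing to the limit loses strictness. It is recovered by applying the weak inequality to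
    [v / 2], where the derivative halves, and strict convexity at the midpoint. *)
Lemma derive_lt_strictly_convex (R : realType) (m : nat) (f : 'cV[R]_m -> R)
    (a v : 'cV[R]_m) : differentiable f a -> strictly_convex f -> v != 0 ->
  'D_v f a < f (a + v) - f a.
Proof.
move=> df fconv v0.
have h0 : 2^-1 *: v != 0 by rewrite scaler_eq0 negb_or invr_eq0 pnatr_eq0.
have := derive_le_convex (@diff_derivable _ _ _ f a (2^-1 *: v) df) fconv h0.
have av : a + v != a by rewrite -subr_eq0 addrC addKr.
have h1 : (2^-1 : R) < 1 by rewrite invf_lt1// ltr1n.
have := fconv _ _ 2^-1 av _ h1; rewrite invr_gt0 ltr0n => /(_ isT).
rewrite (_ : _ *: (a + v) + _ = a + 2^-1 *: v); last first.
  by apply/matrixP => i j; rewrite !mxE; field.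
by rewrite !deriveE// linearZ/= /GRing.scale/=; lra.
Qed.

(** * Unique minimizers through feasible directions *)

(** If [h] in [K] has [A h = 0], a small step along [h] reaches another minimizer unless [h = 0].
    Conversely, the strict gradient inequality makes the objective grow along every feasible
    displacement with [A h != 0]. *)
Lemma unique_minimizer_directions (R : realType) (m N : nat)
    (A : 'M[R]_(m, N)) (y : 'cV[R]_m) (f : 'cV[R]_m -> R)
    (D K : set 'cV[R]_N) (x : 'cV[R]_N) :
  (forall z, differentiable f z) -> strictly_convex f -> D x ->
  (forall h, D (x + h) -> K h) ->
  (forall h, K h -> \forall t \near 0^'+, D (x + t *: h)) ->
  unique_minimizer (D2_objective f A y) D x <->
  (forall h, K h -> A *m h = 0 -> h = 0) /\
  (forall h, K h -> 0 <= ((A^T *m gradient f (A *m x - y))^T *m h) 0 0).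
Proof.
move=> df fconv Dx DK KD.
have objE h : D2_objective f A y (x + h) = f (A *m x - y + A *m h).
  by rewrite /D2_objective mulmxDr addrAC.
have gE h : ((A^T *m gradient f (A *m x - y))^T *m h) 0 0 =
    'D_(A *m h) f (A *m x - y).
  by rewrite derive_gradient// trmx_mul trmxK mulmxA.
split=> [[[_ xmin] xuniq]|[K0 Kg]].
  split=> h Kh.
    move=> A0; have [t [t0 Dt]] : exists t : R, 0 < t /\ D (x + t *: h).
      near (0:R)^'+ => t; exists t; split; near: t; last exact: KD.
      exact: nbhs_right_gt.
    have /eqP : x + t *: h = x.
      apply: xuniq; split=> // z Dz; rewrite objE -scalemxAr A0 scaler0 addr0.
      exact: xmin.
    rewrite -subr_eq0 addrC addKr scaler_eq0 gt_eqF//=.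
    by move/eqP.
  rewrite gE; apply: derive_ge0_right; first exact: diff_derivable.
  near=> t; rewrite scalemxAr -objE; apply: xmin.
  by near: t; exact: KD.
(* One claim serves twice: on a strict decrease it gives minimality, on another minimizer it gives
   uniqueness. *)
have key h : D (x + h) -> f (A *m x - y + A *m h) <= f (A *m x - y) -> h = 0.
  move=> /DK Kh fh; apply: (K0 h Kh); apply/eqP/negPn/negP => Ah.
  have := derive_lt_strictly_convex (df (A *m x - y)) fconv Ah.
  by have := Kg h Kh; rewrite gE; lra.
have fx : f (A *m x - y) = D2_objective f A y x by [].
have xE z : z = x + (z - x) by rewrite addrC subrK.
have xmin z : D z -> D2_objective f A y x <= D2_objective f A y z.
  rewrite (xE z); move: (z - x) => h Dh; rewrite objE -fx leNgt; apply/negP => fh.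
  by move: (fh); rewrite (key h Dh (ltW fh)) mulmx0 addr0 ltxx.
split=> // z [Dz zmin]; rewrite (xE z); rewrite (key (z - x)) ?addr0// -?xE//.
by rewrite -objE -xE; exact: zmin.
Unshelve. all: by end_near. Qed.

(** * Feasible directions of the two constraints *)

Lemma near_right_mul_le (R : realType) (s e : R) :
  0 < e -> \forall t \near 0^'+, t * s <= e.
Proof.
move=> e0; have s0 : 0 < `|s| + 1 by rewrite ltr_wpDl.
near=> t.
have t0 : 0 < t by near: t; exact: nbhs_right_gt.
have : t < e / (`|s| + 1) by near: t; apply: nbhs_right_lt; exact: divr_gt0.
rewrite ltr_pdivlMr// => /ltW; apply: le_trans.
by rewrite ler_pM2l//; have := ler_norm s; lra.
Unshelve. all: by end_near. Qed.

Lemma mul_rows_of (R : realType) (n q r : nat) (B : {set 'I_n}) (M : 'M[R]_(n, q))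
    (h : 'M[R]_(q, r)) : rows_of B M *m h = rows_of B (M *m h).
Proof. by apply/matrixP => i j; rewrite !mxE; apply: eq_bigr => k _; rewrite mxE. Qed.

Lemma vle_rows_of (R : realType) (n : nat) (B : {set 'I_n}) (u : 'cV[R]_n) :
  vle 0 (rows_of B u) <-> forall i, i \in B -> 0 <= u i 0.
Proof.
split=> [/vle0P u0 i iB|u0]; last first.
  by apply/vle0P => i; rewrite mxE; apply: u0; exact: enum_valP.
by have := u0 (enum_rank_in iB i); rewrite mxE enum_rankK_in.
Qed.

(* The one-sided directional derivative of [norm1 (E *m _)] at [x] along [h]. *)
Lemma norm1_slopeE (R : realType) (k N : nat) (E : 'M[R]_(k, N)) (x h : 'cV[R]_N) :
  ((bvec E x)^T *m h) 0 0 + norm1 (rows_of (~: supp E x) E *m h) =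
  \sum_i (if (E *m x) i 0 == 0 then `|(E *m h) i 0|
          else Num.sg ((E *m x) i 0) * (E *m h) i 0).
Proof.
rewrite /bvec trmx_mul trmxK -mulmxA !mul_rows_of.
rewrite (bigID (mem (supp E x)))/=; congr (_ + _).
  rewrite mxE; under [RHS]eq_bigr => i.
    rewrite inE => /negbTE ->; over.
  rewrite [RHS]big_enum_val/=; apply: eq_bigr => i _.
  by rewrite !mxE.
transitivity (\sum_(i in ~: supp E x) `|(E *m h) i 0|).
  by rewrite [RHS]big_enum_val/=; apply: eq_bigr => i _; rewrite [_ i 0]mxE.
apply: eq_big => [i|i]; first by rewrite !inE.
by rewrite !inE negbK => ->.
Qed.

(** Subgradient inequality, entry by entry: [|a| + sgn(a) b = sgn(a) (a + b) <= |a + b|] when [a] is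
    nonzero. It holds for displacements of any size. *)
Lemma norm1_slope_le (R : realType) (k N : nat) (E : 'M[R]_(k, N)) (x h : 'cV[R]_N) :
  norm1 (E *m x) + (((bvec E x)^T *m h) 0 0 + norm1 (rows_of (~: supp E x) E *m h))
    <= norm1 (E *m (x + h)).
Proof.
rewrite norm1_slopeE /norm1 -big_split/=; apply: ler_sum => i _.
rewrite mulmxDr [(E *m x + E *m h) i 0]mxE.
case: eqVneq => [->|x0]; first by rewrite normr0 !add0r.
rewrite [`|(E *m x) i 0|]normrEsg -mulrDr; apply: le_trans (ler_norm _) _.
by rewrite normrM normr_sg x0 mul1r.
Qed.

(** The 1-norm is piecewise linear, so for small steps the first-order expansion is exact and a
    nonpositive slope suffices to stay within the bound. *)
Lemma norm1_slope_near (R : realType) (k N : nat) (E : 'M[R]_(k, N)) (x h : 'cV[R]_N) :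
  \forall t \near 0^'+, norm1 (E *m (x + t *: h)) = norm1 (E *m x) +
    t * (((bvec E x)^T *m h) 0 0 + norm1 (rows_of (~: supp E x) E *m h)).
Proof.
have nE i : \forall t \near (0 : R)^'+, `|(E *m (x + t *: h)) i 0| =
    `|(E *m x) i 0| + t * (if (E *m x) i 0 == 0 then `|(E *m h) i 0|
          else Num.sg ((E *m x) i 0) * (E *m h) i 0).
  have [x0|x0] := eqVneq ((E *m x) i 0) 0; near=> t.
    have t0 : 0 < t by near: t; exact: nbhs_right_gt.
    rewrite mulmxDr -scalemxAr [(E *m x + _) i 0]mxE [(t *: (E *m h)) i 0]mxE x0.
    by rewrite normr0 !add0r normrM gtr0_norm.
  have t0 : 0 < t by near: t; exact: nbhs_right_gt.
  rewrite mulmxDr -scalemxAr [(E *m x + _) i 0]mxE [(t *: (E *m h)) i 0]mxE.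
  have sgE u : `|Num.sg ((E *m x) i 0) * u| = `|u|.
    by rewrite normrM normr_sg x0 mul1r.
  (* So small a perturbation cannot reverse the sign of the entry; multiplying by that sign then
     removes the absolute value. *)
  have : t * `|(E *m h) i 0| <= `|(E *m x) i 0|.
    by near: t; apply: near_right_mul_le; rewrite normr_gt0.
  rewrite -[LHS]sgE mulrDr -normrEsg mulrCA -(gtr0_norm t0) -sgE mulrCA -normrM.
  rewrite (gtr0_norm t0) => th; rewrite ger0_norm//.
  by have := ler_norm (- (t * (Num.sg ((E *m x) i 0) * (E *m h) i 0)));
     rewrite normrN; lra.
near=> t.
have tE : forall i, _ :=
  near (filter_forall (at_right_proper_filter (0:R)) nE) t.
rewrite norm1_slopeE /norm1 mulr_sumr -big_split/=.
by apply: eq_bigr => i _; exact: tE.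
Unshelve. all: by end_near. Qed.

Lemma active_direction (R : realType) (p N : nat) (C : 'M[R]_(p, N))
    (d : 'cV[R]_p) (x h : 'cV[R]_N) :
  vle d (C *m (x + h)) -> vle 0 (rows_of (active_set C d x) C *m h).
Proof.
move=> dC; rewrite mul_rows_of; apply/vle_rows_of => i.
rewrite inE !mxE subr_eq0 => /eqP Cd.
by have := dC i; rewrite mulmxDr !mxE Cd lerDl.
Qed.

(** Active rows do not decrease along [h]; each inactive row has positive slack, which absorbs a
    small step. *)
Lemma active_direction_near (R : realType) (p N : nat) (C : 'M[R]_(p, N))
    (d : 'cV[R]_p) (x h : 'cV[R]_N) :
  vle d (C *m x) -> vle 0 (rows_of (active_set C d x) C *m h) ->
  \forall t \near 0^'+, vle d (C *m (x + t *: h)).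
Proof.
move=> dC; rewrite mul_rows_of => /vle_rows_of Ch.
apply: filter_forall => i.
have xhE t : (C *m (x + t *: h)) i 0 = (C *m x) i 0 + t * (C *m h) i 0.
  by rewrite mulmxDr -scalemxAr [LHS]mxE [(t *: (C *m h)) i 0]mxE.
have [ia|] := boolP (i \in active_set C d x).
  near=> t; rewrite xhE; apply: (le_trans (dC i)).
  rewrite lerDl mulr_ge0 ?Ch// ltW//; near: t; exact: nbhs_right_gt.
rewrite inE [(C *m x - d) i 0]mxE [(- d) i 0]mxE => xd.
near=> t; rewrite xhE.
suff : t * (- (C *m h) i 0) <= (C *m x) i 0 - d i 0 by lra.
near: t; apply: near_right_mul_le.
by rewrite lt0r xd subr_ge0 dC.
Unshelve. all: by end_near. Qed.

(** * The inactive and active cases of the norm constraint *)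

Unset Implicit Arguments.

(* On column vectors the library norm `|v| is the sup norm. *)
Theorem proposition4p4 (R : realType) (k m p N : nat)
    (E : 'M[R]_(k, N)) (A : 'M[R]_(m, N)) (y : 'cV[R]_m)
    (C : 'M[R]_(p, N)) (d : 'cV[R]_p) (eta : R) (f : 'cV[R]_m -> R)
    (hE : E != 0) (heta : 0 < eta) (hC1 : C1 f) (hconv : strictly_convex f)
    (hsol : exists z : 'cV[R]_N,
      minimizer (D2_objective f A y) (D2_feasible E C d eta) z)
    (xs : 'cV[R]_N) (hxs : D2_feasible E C d eta xs) :
  let Ca := rows_of (active_set C d xs) C in
  let Sc := (~: supp E xs)%SET in
  let ESc := rows_of Sc E in
  let b := bvec E xs in
  let g := gradient f (A *m xs - y) in
  (norm1 (E *m xs) < eta ->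
    (unique_minimizer (D2_objective f A y) (D2_feasible E C d eta) xs <->
     full_col_rank (col_mx A Ca) /\
     exists (w : 'cV[R]_m) (w' u : 'cV[R]_#|active_set C d xs|),
       [/\ vlt 0 w', vle 0 u,
           A^T *m w = Ca^T *m w' &
           A^T *m g = Ca^T *m u]))
  /\
  (norm1 (E *m xs) = eta ->
    (unique_minimizer (D2_objective f A y) (D2_feasible E C d eta) xs <->
     [/\ full_col_rank (col_mx A (col_mx Ca ESc)),
         exists (u : 'cV[R]_m) (u' : 'cV[R]_#|active_set C d xs|)
             (u'' : 'cV[R]_#|Sc|),
           [/\ vlt 0 u', `|u''| < 1 &
               A^T *m u + Ca^T *m u' - ESc^T *m u'' = b] &
         exists (ut : 'cV[R]_#|active_set C d xs|) (mu : R)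
             (ut' : 'cV[R]_#|Sc|),
           [/\ vle 0 ut, 0 <= mu, `|ut'| <= 1 &
               A^T *m g - Ca^T *m ut + mu *: (b + ESc^T *m ut') = 0]])).
Proof.
move=> Ca Sc ESc b g; have [df _] := hC1; have [nx dx] := hxs.
have xh h : D2_feasible E C d eta (xs + h) -> vle 0 (Ca *m h).
  by move=> [_]; exact: active_direction.
split=> nE.
  have KD h : vle 0 (Ca *m h) ->
      \forall t \near 0^'+, D2_feasible E C d eta (xs + t *: h).
    (* The positive slack in the norm constraint absorbs a small step whatever the slope. *)
    move=> Kh; have e0 : 0 < eta - norm1 (E *m xs) by rewrite subr_gt0.
    have := active_direction_near dx Kh.
    have := near_right_mul_le ((b^T *m h) 0 0 + norm1 (ESc *m h)) e0.
    have := norm1_slope_near E xs h.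
    apply: filterS3 => t tE te tC; split=> //.
    by rewrite tE -lerBrDl.
  have -> := @unique_minimizer_directions _ _ _ A y f _
    [set h | vle 0 (Ca *m h)] _ df hconv hxs xh KD.
  rewrite [X in X /\ _]cone_stiemke [X in _ /\ X]cone_farkas.
  split=> [[[rk [w [w' [w0 wE]]]] [u u0 uE]]|[rk [w [w' [u [w0 u0 wE uE]]]]]].
    by split=> //; exists w, w', u.
  by split; [split=> //; exists w, w' | exists u].
(* With no slack left, the subgradient inequality forces the slope along a feasible displacement to
   be nonpositive. *)
have xK h : D2_feasible E C d eta (xs + h) ->
    vle 0 (Ca *m h) /\ (b^T *m h) 0 0 + norm1 (ESc *m h) <= 0.
  move=> Dh; split; first exact: xh.
  case: Dh => + _; have := norm1_slope_le E xs h; rewrite nE -/b -/ESc; lra.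
have KD h : vle 0 (Ca *m h) /\ (b^T *m h) 0 0 + norm1 (ESc *m h) <= 0 ->
    \forall t \near 0^'+, D2_feasible E C d eta (xs + t *: h).
  move=> [Kh bh]; have := active_direction_near dx Kh.
  have := norm1_slope_near E xs h; have := @nbhs_right_gt R 0.
  apply: filterS3 => t t0 tE tC; split=> //.
  by rewrite tE nE gerDl mulr_ge0_le0// ltW.
have -> := @unique_minimizer_directions _ _ _ A y f _
  [set h | vle 0 (Ca *m h) /\ (b^T *m h) 0 0 + norm1 (ESc *m h) <= 0]
  _ df hconv hxs xK KD.
rewrite [X in X /\ _]l1_cone_stiemke [X in _ /\ X]l1_cone_farkas.
by split=> [[[]]|[]].
Qed.
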